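(* Let $p\in(0,1)$, $q=1/p$, and let $\varphi:\mathcal D^1_n\to N_q$, $\varphi(\rho)=q\rho^{1/q}$, be the Amari embedding. Then the dualised pull-back $$\langle A,B\rangle^{\varphi}_\rho:=\big\langle D_\rho\varphi(A),\,D_\rho(J\circ\varphi)(B)\big\rangle,\qquad \rho\in\mathcal D_n^1,\ A,B\in T_\rho\mathcal D^1_n,$$ coincides with the Wigner--Yanase--Dyson information (of parameter $p$).
   Context: $M_n$ is the space of $n\times n$ complex matrices; $\mathcal D_n^1$ is the manifold of strictly positive matrices in $M_n$ with trace $1$; its tangent space $T_\rho\mathcal D_n^1$ is the space of self-adjoint trace-zero matrices. For $q\in(1,\infty)$ let $\tilde q$ be defined by $\frac1q+\frac1{\tilde q}=1$ and let $N_q$ be $M_n$ with the norm $\|A\|_{N_q}=q^{-1}(\mathrm{Tr}|A|^q)^{1/q}$. The dual of $N_q$ is identified isometrically with $N_{\tilde q}$ through the pairing $\langle F,G\rangle=\mathrm{Tr}\big(\frac{F}{q}\frac{G}{\tilde q}\big)$, $F\in N_q$, $G\in N_{\tilde q}$. The duality mapping $J:N_q\to N_{\tilde q}$ sends $V$ to the unique element $J(V)$ with $\langle V,J(V)\rangle=\|V\|_{N_q}^2=\|J(V)\|_{N_{\tilde q}}^2$; in particular $J(q\rho^{1/q})=\tilde q\rho^{1/\tilde q}$ for $\rho\in\mathcal D^1_n$. $D_\rho$ denotes the differential at $\rho$ of maps defined on $\mathcal D_n^1$. The Wigner--Yanase--Dyson information content is $I_p(\rho,U)=-\mathrm{Tr}([\rho^p,U][\rho^{1-p},U])$,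 $U$ self-adjoint. It is seen as a monotone metric on $\mathcal D_n^1$ as follows: it is the scalar multiple of the metric $(A,B)\mapsto\mathrm{Tr}\big(A\,c_{f_p}(L_\rho,R_\rho)(B)\big)$ whose value on the tangent vector $A=B=i[\rho,U]$ is $I_p(\rho,U)$. Here $f_p(x)=p(1-p)\frac{(x-1)^2}{(x^p-1)(x^{1-p}-1)}$ (with $f_p(1)=1$), $c_{f_p}(x,y)=\frac{1}{yf_p(xy^{-1})}$ for $x,y>0$, $L_\rho(A)=\rho A$, $R_\rho(A)=A\rho$, and $c_{f_p}(L_\rho,R_\rho)(B)=\sum_{i,j}c_{f_p}(\lambda_i,\lambda_j)E_iBE_j$ for the spectral decomposition $\rho=\sum_i\lambda_iE_i$. *)

(* Defs.v *)
From HB Require Import structures.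
From mathcomp Require Import all_boot all_order all_algebra.
From mathcomp Require Import sesquilinear spectral.
From mathcomp Require Import all_classical all_reals all_analysis.
From mathcomp Require Import complex.

Set Implicit Arguments.
Unset Strict Implicit.
Unset Printing Implicit Defensive.

Import Order.TTheory GRing.Theory Num.Theory.
Import numFieldNormedType.Exports.

Local Open Scope ring_scope.
Local Open Scope classical_set_scope.
Local Open Scope sesquilinear_scope.
Local Open Scope complex_scope.

(* The library topologizes abstract numFieldTypes, not the carrier R[i]. *)
#[non_forgetful_inheritance]
HB.instance Definition _ (R : realType) := NormedModule.copy R[i] R[i]^o.

Section SpectralCalculus.
Context {R : realType} {n : nat}.
Implicit Types (f : R -> R) (A B : 'M[R[i]]_n).

(* For A self-adjoint, A = \sum_i (eigval A i)%:C *: eigproj A i, where the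
   eigproj A i are the rank-one projections on an orthonormal eigenbasis, so
   that eigenvalues are repeated according to their multiplicity. *)
Definition eigval A (i : 'I_n) : R := complex.Re (spectral_diag A 0 i).

Definition eigproj A (i : 'I_n) : 'M[R[i]]_n :=
  invmx (spectralmx A) *m delta_mx i i *m spectralmx A.

Definition mxfun f A : 'M[R[i]]_n :=
  \sum_i (f (eigval A i))%:C *: eigproj A i.

Definition mxpow A (r : R) : 'M[R[i]]_n := mxfun (fun x => x `^ r) A.

Definition mxabs A : 'M[R[i]]_n := mxfun Num.sqrt (A ^t* *m A).

(* c(L_A, R_A)(B) *)
Definition mxfunLR (c : R -> R -> R) A B : 'M[R[i]]_n :=
  \sum_i \sum_j (c (eigval A i) (eigval A j))%:C *:
    (eigproj A i *m B *m eigproj A j).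

Definition commutator A B : 'M[R[i]]_n := A *m B - B *m A.

End SpectralCalculus.

Section DensityMatrices.
Context {R : realType} {n : nat}.

Definition strictly_positive (A : 'M[R[i]]_n) : Prop :=
  A \is hermsymmx /\
  forall v : 'rV[R[i]]_n, v != 0 -> 0 < (v *m A *m v ^t*) 0 0.

Definition density : set 'M[R[i]]_n :=
  [set rho | strictly_positive rho /\ \tr rho = 1].

Definition tangent : set 'M[R[i]]_n :=
  [set A | A \is hermsymmx /\ \tr A = 0].

(* The manifold [density] is open in the real affine space
   rho + [tangent], so the differential at rho is the R-linear map on
   [tangent] (values elsewhere are irrelevant) giving the first-order
   expansion along [density]. *)
Definition is_differential (f : 'M[R[i]]_n -> 'M[R[i]]_n) (rho : 'M[R[i]]_n)
    (L : 'M[R[i]]_n -> 'M[R[i]]_n) : Prop :=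
  (forall (a : R) A B, tangent A -> tangent B ->
     L (a%:C *: A + B) = a%:C *: L A + L B) /\
  (forall x, f x = f rho + L (x - rho)
     +o_(x \near within density (nbhs rho)) (x - rho)).

Definition differentiable_density (f : 'M[R[i]]_n -> 'M[R[i]]_n)
    (rho : 'M[R[i]]_n) : Prop := exists L, is_differential f rho L.

Definition differential (f : 'M[R[i]]_n -> 'M[R[i]]_n) (rho : 'M[R[i]]_n) :
    'M[R[i]]_n -> 'M[R[i]]_n :=
  xget (fun=> 0) [set L | is_differential f rho L].

End DensityMatrices.

Section AmariEmbedding.
Context {R : realType} {n : nat}.
Implicit Types (q qt : R) (rho A B F G V W : 'M[R[i]]_n).

Definition normN q A : R :=
  q^-1 * (complex.Re (\tr (mxpow (mxabs A) q))) `^ q^-1.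

Definition pairing q qt F G : R[i] :=
  \tr (((q^-1)%:C *: F) *m ((qt^-1)%:C *: G)).

Definition duality_map q qt V : 'M[R[i]]_n :=
  xget 0 [set W | pairing q qt V W = ((normN q V) ^+ 2)%:C /\
                  (normN q V) ^+ 2 = (normN qt W) ^+ 2].

Definition amari q rho : 'M[R[i]]_n := q%:C *: mxpow rho q^-1.

Definition dual_pullback q qt (phi : 'M[R[i]]_n -> 'M[R[i]]_n) rho A B :
    R[i] :=
  pairing q qt (differential phi rho A)
    (differential (duality_map q qt \o phi) rho B).

End AmariEmbedding.

Section WignerYanaseDyson.
Context {R : realType} {n : nat}.
Implicit Types (p : R) (rho A B U : 'M[R[i]]_n).

Definition WYD_information p rho U : R[i] :=
  - \tr (commutator (mxpow rho p) U *m commutator (mxpow rho (1 - p)) U).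

Definition WYD_fun p (x : R) : R :=
  if x == 1 then 1
  else p * (1 - p) * ((x - 1) ^+ 2 / ((x `^ p - 1) * (x `^ (1 - p) - 1))).

Definition chentsov_fun (f : R -> R) (x y : R) : R := (y * f (x / y))^-1.

Definition monotone_metric (f : R -> R) rho A B : R[i] :=
  \tr (A *m mxfunLR (chentsov_fun f) rho B).

Definition is_WYD_metric p
    (g : 'M[R[i]]_n -> 'M[R[i]]_n -> 'M[R[i]]_n -> R[i]) : Prop :=
  exists k : R,
    (forall rho A B, density rho -> tangent A -> tangent B ->
       g rho A B = k%:C * monotone_metric (WYD_fun p) rho A B) /\
    (forall rho U, density rho -> U \is hermsymmx ->
       g rho ('i *: commutator rho U) ('i *: commutator rho U)
         = WYD_information p rho U).

End WignerYanaseDyson.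

(* Main.v *)
(** Let [E_i], [lambda_i] be the spectral data of [rho], and [F_j], [mu_j] those
    of a nearby [x].  For any function [f] the identity
    [E_i (f x - f rho) F_j = f[lambda_i, mu_j] E_i (x - rho) F_j], with
    [f[.,.]] the divided difference, is exact.  Hence the differential of
    [rho |-> f rho] is [B |-> \sum_(i,j) f[lambda_i, lambda_j] E_i B E_j], the
    remainder being governed by the continuity at [rho] of the functional
    calculus of the functions [f[lambda_i, .]].

    On the image of the Amari embedding the duality mapping is
    [q rho^(1/q) |-> qt rho^(1/qt)]: uniqueness is the equality case of the
    trace Hölder inequality, obtained from a singular value decomposition and
    the equality case of Young's inequality.

    The dualised pull-back is therefore the bilinear form whose coefficients
    are the products of the divided differences of [x^p] and [x^(1-p)], which
    is [p (1 - p) c_{f_p}]; and on [i [rho, U]] the two differentials are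
    [i [rho^p, U]] and [i [rho^(1-p), U]]. *)

Require Import Defs.
From HB Require Import structures.
From mathcomp Require Import all_boot all_order all_algebra.
From mathcomp Require Import sesquilinear spectral.
From mathcomp Require Import all_classical all_reals all_analysis.
From mathcomp Require Import complex.
From mathcomp Require Import ring.

Set Implicit Arguments.
Unset Strict Implicit.
Unset Printing Implicit Defensive.

Import Order.TTheory GRing.Theory Num.Theory.
Import numFieldNormedType.Exports.

Local Open Scope ring_scope.
Local Open Scope classical_set_scope.

(** * Matrices diagonalized by a unitary matrix *)

Section UnitaryDiagonalization.
Local Open Scope sesquilinear_scope.
Context {C : numClosedFieldType} {n : nat}.
Implicit Types (A B M S T V : 'M[C]_n) (d e : 'I_n -> C).

Definition dgmx d : 'M[C]_n := diag_mx (\row_i d i).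

Definition udiag V d : 'M[C]_n := V^t* *m dgmx d *m V.

Lemma mul_dgmxE d A i j : (dgmx d *m A) i j = d i * A i j.
Proof. by rewrite mul_diag_mx !mxE. Qed.

Lemma mul_mx_dgmxE d A i j : (A *m dgmx d) i j = A i j * d j.
Proof. by rewrite mul_mx_diag !mxE. Qed.

Lemma dgmx_adj d : (forall i, d i \is Num.real) -> (dgmx d)^t* = dgmx d.
Proof.
move=> rd; rewrite tr_diag_mx map_diag_mx; congr diag_mx; apply/rowP => i.
by rewrite !mxE /= conj_Creal.
Qed.

Lemma mul_dgmx d e : dgmx d *m dgmx e = dgmx (fun i => d i * e i).
Proof.
by apply/matrixP => i j; rewrite mul_dgmxE !mxE mulrnAr.
Qed.

Lemma unitary_mulV V : V \is unitarymx -> V *m V^t* = 1%:M.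
Proof. by move/unitarymxP. Qed.

Lemma unitary_mulVl V : V \is unitarymx -> V^t* *m V = 1%:M.
Proof. by rewrite -trmxC_unitary => /unitarymxP; rewrite trmxCK. Qed.

Lemma adjmxZ a A : a \is Num.real -> (a *: A)^t* = a *: A^t*.
Proof. by move=> ra; rewrite linearZ /= map_mxZ /= conj_Creal. Qed.

Lemma udiag_adj V d : (forall i, d i \is Num.real) -> (udiag V d)^t* = udiag V d.
Proof. by move=> rd; rewrite !trmx_mul !map_mxM trmxCK dgmx_adj // mulmxA. Qed.

Lemma hermsymmxP A : reflect (A^t* = A) (A \is hermsymmx).
Proof. by rewrite is_hermitianmxE expr0 scale1r eq_sym; apply/eqP. Qed.

Lemma udiag_herm V d : (forall i, d i \is Num.real) -> udiag V d \is hermsymmx.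
Proof. by move=> rd; apply/hermsymmxP; rewrite udiag_adj. Qed.

Lemma tr_udiag V d : V \is unitarymx -> \tr (udiag V d) = \sum_i d i.
Proof.
move=> uV; rewrite /udiag mxtrace_mulC mulmxA unitary_mulV // mul1mx.
by rewrite mxtrace_diag; apply: eq_bigr => i _; rewrite mxE.
Qed.

Lemma scale_udiag V d a : a *: udiag V d = udiag V (fun i => a * d i).
Proof.
rewrite /udiag scalemxAl scalemxAr; congr (_ *m _ *m _).
by apply/matrixP => i j; rewrite !mxE mulrnAr.
Qed.

Lemma mulmx_udiagl V d : V \is unitarymx -> V *m udiag V d = dgmx d *m V.
Proof. by move=> uV; rewrite /udiag !mulmxA unitary_mulV // mul1mx. Qed.

Lemma mulmx_udiagr V d : V \is unitarymx -> udiag V d *m V^t* = V^t* *m dgmx d.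
Proof. by move=> uV; rewrite /udiag -!mulmxA unitary_mulV // mulmx1. Qed.

Lemma mul_udiag V d e : V \is unitarymx ->
  udiag V d *m udiag V e = udiag V (fun i => d i * e i).
Proof.
move=> uV; rewrite {1}/udiag -(mulmxA _ V) mulmx_udiagl //.
by rewrite mulmxA -(mulmxA _ (dgmx d)) mul_dgmx.
Qed.

(** With [S] on the left and [T] on the right both matrices act diagonally, so their difference acts
    entrywise on the overlap matrix [S *m T^t*]. No matching between the two spectra enters. *)
Lemma udiag_intertwine S T d e i j : S \is unitarymx -> T \is unitarymx ->
  (S *m (udiag T e - udiag S d) *m T^t*) i j = (e j - d i) * (S *m T^t*) i j.
Proof.
move=> uS uT; rewrite mulmxBr mulmxBl mulmx_udiagl // -(mulmxA S) mulmx_udiagr //.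
rewrite (mulmxA S) -(mulmxA (dgmx d)).
move: (S *m T^t*) => X.
have -> (M N : 'M[C]_n) : (M - N) i j = M i j - N i j by rewrite !mxE.
by rewrite mul_dgmxE mul_mx_dgmxE mulrBl mulrC.
Qed.

Lemma eigproj_sum (c : 'I_n -> C) S : S \is unitarymx ->
  \sum_i c i *: (invmx S *m delta_mx i i *m S) = udiag S c.
Proof.
move=> uS; rewrite /udiag /dgmx diag_mx_sum_delta mulmx_sumr mulmx_suml.
apply: eq_bigr => i _; rewrite invmx_unitary //.
by rewrite mxE -scalemxAr -scalemxAl.
Qed.

Lemma hermitian_spectral A : A \is hermsymmx ->
  A = udiag (spectralmx A) (fun i => spectral_diag A 0 i).
Proof.
move=> hA; have /orthomx_spectralP {1}-> := hermitian_normalmx hA.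
rewrite invmx_unitary ?spectral_unitarymx //; congr (_ *m diag_mx _ *m _).
by apply/rowP => i; rewrite mxE.
Qed.

Lemma spectral_diag_real A i : A \is hermsymmx ->
  spectral_diag A 0 i \is Num.real.
Proof. by move=> hA; have /mxOverP -> := hermitian_spectral_diag_real hA. Qed.

(** Independence of the functional calculus from the diagonalization: overlaps between eigenvectors
    of distinct eigenvalues vanish, and equal eigenvalues have equal images by hypothesis. *)
Lemma udiag_transfer S T d e d' e' : S \is unitarymx -> T \is unitarymx ->
  (forall i j, e j = d i -> e' j = d' i) ->
  udiag T e = udiag S d -> udiag T e' = udiag S d'.
Proof.
move=> uS uT ed eq_de; apply/eqP; rewrite -subr_eq0; apply/eqP.
suff K0 : S *m (udiag T e' - udiag S d') *m T^t* = 0.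
  move: K0 => /(congr1 (fun M => S^t* *m M *m T)).
  rewrite mulmx0 mul0mx !mulmxA unitary_mulVl // mul1mx -!mulmxA.
  by rewrite unitary_mulVl // mulmx1.
apply/matrixP => i j; rewrite udiag_intertwine // [RHS]mxE.
have := udiag_intertwine d e i j uS uT.
rewrite eq_de subrr mulmx0 mul0mx [LHS]mxE => /esym/eqP.
rewrite mulf_eq0 subr_eq0 => /orP[/eqP/ed->|/eqP ->]; last by rewrite mulr0.
by rewrite subrr mul0r.
Qed.

(** The Schur multiplier with symbol [c], taken in the basis given by the unitary [S]. *)
Definition sandwich S (c : 'I_n -> 'I_n -> C) B : 'M[C]_n :=
  S^t* *m (\matrix_(i, j) (c i j * (S *m B *m S^t*) i j)) *m S.

Lemma sandwich_linear S c a A B :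
  sandwich S c (a *: A + B) = a *: sandwich S c A + sandwich S c B.
Proof.
rewrite /sandwich scalemxAl scalemxAr -mulmxDl -mulmxDr; congr (_ *m _ *m _).
apply/matrixP => i j; rewrite mulmxDr mulmxDl -scalemxAr -scalemxAl.
move: (S *m A *m _) (S *m B *m _) => M N; rewrite !mxE.
by rewrite mulrDr mulrCA.
Qed.

Lemma spectral_sandwichE (c : 'I_n -> 'I_n -> C) S B : S \is unitarymx ->
  \sum_i \sum_j c i j *: ((invmx S *m delta_mx i i *m S) *m B *m
                          (invmx S *m delta_mx j j *m S)) =
  sandwich S c B.
Proof.
rewrite /sandwich => uS; set K := S *m B *m S^t*.
have -> : (\matrix_(i, j) (c i j * K i j) : 'M[C]_n) =
    \sum_i \sum_j c i j *: (delta_mx i i *m K *m delta_mx j j).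
  rewrite [LHS]matrix_sum_delta; apply: eq_bigr => i _; apply: eq_bigr => j _.
  rewrite mxE -scalerA; congr (_ *: _).
  rewrite [K in RHS]matrix_sum_delta mulmx_sumr mulmx_suml (bigD1 i) //=.
  rewrite mulmx_sumr mulmx_suml (bigD1 j) //= -scalemxAr -scalemxAl.
  rewrite mul_delta_mx mul_delta_mx !big1 ?addr0 // => k /negPf nk.
    rewrite mulmx_sumr mulmx_suml big1 // => l _.
    by rewrite -scalemxAr -scalemxAl mul_delta_mx_cond eq_sym nk mulr0n mul0mx scaler0.
  by rewrite -scalemxAr -scalemxAl mul_delta_mx mul_delta_mx_cond nk mulr0n scaler0.
rewrite mulmx_sumr mulmx_suml; apply: eq_bigr => i _.
rewrite mulmx_sumr mulmx_suml; apply: eq_bigr => j _.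
rewrite -scalemxAr -scalemxAl; congr (_ *: _).
by rewrite invmx_unitary // /K !mulmxA.
Qed.

End UnitaryDiagonalization.

(** * Norms and quadratic forms *)

Section MatrixNorm.
Local Open Scope sesquilinear_scope.
Context {C : numClosedFieldType} {n : nat}.
Implicit Types (A B M S T V : 'M[C]_n).

Lemma mx_entry_le M i j : `|M i j| <= `|M|.
Proof.
rewrite [leRHS]/Num.Def.normr /= mx_normE -[leLHS]nngE num_le.
exact: (le_bigmax _ (fun k : 'I_n * 'I_n => `|M k.1 k.2|%:nng) (i, j)).
Qed.

Lemma mx_norm_le M (b : C) : 0 <= b -> (forall i j, `|M i j| <= b) -> `|M| <= b.
Proof.
move=> /nonnegP[{}b] Mb; rewrite [leLHS]/Num.Def.normr /= mx_normE num_le.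
by apply/bigmax_leP; split=> [|[i j] _]; rewrite -num_le //=.
Qed.

(** The norm is the largest modulus of an entry, so every product costs a factor [n]; this is the
    source of the powers of [n] in the estimates below. *)
Lemma mx_normM A B : `|A *m B| <= n%:R * (`|A| * `|B|).
Proof.
apply: mx_norm_le => [|i j]; first by rewrite !mulr_ge0.
rewrite mxE (le_trans (ler_norm_sum _ _ _)) //.
rewrite -[X in X%:R]card_ord mulr_natl -sumr_const ler_sum // => k _.
by rewrite normrM ler_pM ?mx_entry_le.
Qed.

Lemma unitary_row_norm V i : V \is unitarymx -> \sum_j `|V i j| ^+ 2 = 1.
Proof.
move=> uV; have := congr1 (fun M => M i i) (unitary_mulV uV).
rewrite !mxE eqxx mulr1n => <-; apply: eq_bigr => j _.
by rewrite !mxE normCK.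
Qed.

Lemma unitary_norm_le1 V : V \is unitarymx -> `|V| <= 1.
Proof.
move=> uV; apply: mx_norm_le => // i j.
rewrite -(@expr_le1 _ 2) // -(unitary_row_norm i uV) (bigD1 j) //= lerDl.
by apply: sumr_ge0 => k _; rewrite exprn_ge0.
Qed.

Lemma mx_normM_unitaryl V A : V \is unitarymx -> `|V *m A| <= n%:R * `|A|.
Proof.
move=> uV; apply: le_trans (mx_normM _ _) _; rewrite ler_wpM2l //.
by rewrite ler_piMl // unitary_norm_le1.
Qed.

Lemma mx_normM_unitaryr V A : V \is unitarymx -> `|A *m V| <= n%:R * `|A|.
Proof.
move=> uV; apply: le_trans (mx_normM _ _) _; rewrite ler_wpM2l //.
by rewrite ler_piMr // unitary_norm_le1.
Qed.

End MatrixNorm.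

(** * Quadratic forms and spectral bounds *)

Section QuadraticForm.
Local Open Scope sesquilinear_scope.
Context {C : numClosedFieldType} {n : nat}.
Implicit Types (A B M S T V : 'M[C]_n) (d e : 'I_n -> C) (v : 'rV[C]_n).

Lemma rV_normE v : (v *m v^t*) 0 0 = \sum_i `|v 0 i| ^+ 2.
Proof. by rewrite mxE; apply: eq_bigr => i _; rewrite !mxE normCK. Qed.

Lemma udiag_formE V d v :
  (v *m udiag V d *m v^t*) 0 0 = \sum_i d i * `|(v *m V^t*) 0 i| ^+ 2.
Proof.
have -> : v *m udiag V d *m v^t* = (v *m V^t*) *m dgmx d *m (v *m V^t*)^t*.
  by rewrite trmx_mul map_mxM trmxCK /udiag !mulmxA.
rewrite mxE; apply: eq_bigr => i _.
by rewrite mul_mx_diag !mxE normCK mulrAC mulrC.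
Qed.

Lemma udiag_form_ge V d (b : C) v : V \is unitarymx -> (forall i, b <= d i) ->
  b * (v *m v^t*) 0 0 <= (v *m udiag V d *m v^t*) 0 0.
Proof.
move=> uV bd; rewrite udiag_formE.
have -> : v *m v^t* = (v *m V^t*) *m (v *m V^t*)^t*.
  by rewrite trmx_mul map_mxM trmxCK mulmxA -(mulmxA v) unitary_mulVl // mulmx1.
rewrite rV_normE mulr_sumr ler_sum // => i _.
by rewrite ler_wpM2r ?exprn_ge0.
Qed.

Lemma rV_norm_gt0 v : v != 0 -> 0 < (v *m v^t*) 0 0.
Proof.
move=> v0; rewrite rV_normE lt0r sumr_ge0 ?andbT => [|i _]; last exact: exprn_ge0.
apply: contra v0; rewrite psumr_eq0 => [/allP v0|i _]; last exact: exprn_ge0.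
apply/eqP/rowP => i; rewrite mxE; apply/eqP.
by have := v0 i (mem_index_enum i); rewrite expf_eq0 normr_eq0.
Qed.

Lemma spectral_diag_gt0 A i : A \is hermsymmx ->
  (forall v : 'rV_n, v != 0 -> 0 < (v *m A *m v^t*) 0 0) ->
  0 < spectral_diag A 0 i.
Proof.
move=> hA pA; set S := spectralmx A.
have uS : S \is unitarymx by apply: spectral_unitarymx.
(* The form is tested on the [i]-th row of [S], an eigenvector on which it takes the [i]-th
   eigenvalue as its value. *)
have rowV : row i S *m S^t* = delta_mx 0 i.
  by rewrite -row_mul unitary_mulV // rowE mulmx1.
have /pA : row i S != 0.
  apply: contra_eqN rowV => /eqP->; rewrite mul0mx eq_sym.
  by apply/eqP => /matrixP/(_ 0 i)/eqP; rewrite !mxE !eqxx oner_eq0.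
rewrite {1}(hermitian_spectral hA) udiag_formE rowV (bigD1 i) //= big1.
  by rewrite addr0 !mxE !eqxx normr1 expr1n mulr1.
by move=> j ji; rewrite mxE (negPf ji) andbF normr0 expr0n mulr0.
Qed.

(** Serves to stay in the positive cone along a segment: the form is at least [m - t * a] times the
    squared norm of [v]. *)
Lemma hermitian_form_pos A B (m a t : C) v : A \is hermsymmx -> B \is hermsymmx ->
  (forall i, m <= spectral_diag A 0 i) -> (forall i, - a <= spectral_diag B 0 i) ->
  0 <= t -> t * a < m -> v != 0 -> 0 < (v *m (A + t *: B) *m v^t*) 0 0.
Proof.
move=> hA hB mA aB t0 tam v0.
rewrite mulmxDr mulmxDl -scalemxAr -scalemxAl.
have -> (M N : 'M[C]_1) : (M + t *: N) 0 0 = M 0 0 + t * N 0 0 by rewrite !mxE.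
have := udiag_form_ge v (spectral_unitarymx A) mA.
have := udiag_form_ge v (spectral_unitarymx B) aB.
rewrite -!hermitian_spectral // => lB lA.
apply: lt_le_trans (lerD lA (ler_wpM2l t0 lB)).
by rewrite mulrA -mulrDl mulr_gt0 ?rV_norm_gt0 // mulrN subr_gt0.
Qed.

End QuadraticForm.

(** * Perturbation of the functional calculus *)

Section Perturbation.
Local Open Scope sesquilinear_scope.
Context {C : numClosedFieldType} {n : nat}.
Implicit Types (M S T : 'M[C]_n) (d e : 'I_n -> C).

(** In mixed bases an entry is [e' j - d' i] times an overlap of modulus at most 1. The term in
    [eps] is thus bounded directly, and the term in [K] recombines into an entry of the conjugated
    perturbation. Conjugating and undoing it cost [n%:R ^+ 2] each. *)
Lemma udiag_dist_le S T d e d' e' (eps K : C) :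
  S \is unitarymx -> T \is unitarymx -> 0 <= eps -> 0 <= K ->
  (forall i j, `|e' j - d' i| <= eps + K * `|e j - d i|) ->
  `|udiag T e' - udiag S d'| <=
    n%:R ^+ 2 * (eps + K * (n%:R ^+ 2 * `|udiag T e - udiag S d|)).
Proof.
move=> uS uT eps0 K0 le_ed.
have conj_le M : `|S *m M *m T^t*| <= n%:R ^+ 2 * `|M|.
  apply: le_trans (mx_normM_unitaryr _ _) _; first by rewrite trmxC_unitary.
  by rewrite expr2 -mulrA ler_wpM2l // mx_normM_unitaryl.
have unconj M : `|M| <= n%:R ^+ 2 * `|S *m M *m T^t*|.
  have {1}-> : M = S^t* *m (S *m M *m T^t*) *m T.
    by rewrite -mulmxA mulmxKtV // !mulmxA unitary_mulVl // mul1mx.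
  apply: le_trans (mx_normM_unitaryr _ uT) _.
  by rewrite expr2 -mulrA ler_wpM2l // mx_normM_unitaryl // trmxC_unitary.
apply: le_trans (unconj _) _; rewrite ler_wpM2l ?exprn_ge0 //.
apply: mx_norm_le => [|i j]; first by rewrite addr_ge0 ?mulr_ge0 ?exprn_ge0.
have X1 : `|(S *m T^t*) i j| <= 1.
  apply: le_trans (mx_entry_le _ _ _) _; apply: unitary_norm_le1.
  by rewrite mul_unitarymx // trmxC_unitary.
rewrite udiag_intertwine // normrM.
apply: le_trans (ler_wpM2r (normr_ge0 _) (le_ed i j)) _.
rewrite mulrDl lerD ?ler_piMr // -mulrA ler_wpM2l //.
apply: le_trans (conj_le _); rewrite -normrM -udiag_intertwine //.
exact: mx_entry_le.
Qed.

(* With [G i] the divided difference of [f] at the [i]-th eigenvalue [d i],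
   the Taylor remainder of the functional calculus is, row by row, the
   perturbation multiplied by the variation of [G i] itself: continuity of
   the functional calculus of the [G i] yields differentiability for [f]. *)
Lemma udiag_taylor S T d e d' e' (G Gd : 'I_n -> 'I_n -> C)
    (H := udiag T e - udiag S d) :
  S \is unitarymx -> T \is unitarymx ->
  (forall i j, e' j - d' i = G i j * (e j - d i)) -> forall i,
  row i (S *m (udiag T e' - udiag S d' - sandwich S Gd H)) =
  row i (S *m H *m (udiag T (G i) - udiag S (Gd i))).
Proof.
move=> uS uT GE i.
have entry (M : 'M[C]_n) k : row i M 0 k = M i k by rewrite mxE.
have exact_part : row i (S *m (udiag T e' - udiag S d')) =
    row i (S *m H *m udiag T (G i)).
  have cancelT (u v : 'rV[C]_n) : u *m T^t* = v *m T^t* -> u = v.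
    by move=> /(congr1 (mulmx^~ T)); rewrite !mulmxKtV.
  apply: cancelT; rewrite -!row_mul -(mulmxA (S *m H)) mulmx_udiagr // mulmxA.
  apply/rowP => j; rewrite !entry mul_mx_dgmxE !udiag_intertwine // GE.
  by rewrite -mulrA mulrC.
have linear_part : row i (S *m sandwich S Gd H) =
    row i (S *m H *m udiag S (Gd i)).
  rewrite /udiag /sandwich !mulmxA unitary_mulV // mul1mx.
  rewrite row_mul [RHS]row_mul; congr (_ *m _).
  by apply/rowP => j; rewrite !entry mul_mx_dgmxE [LHS]mxE mulrC.
rewrite mulmxBr (mulmxBr (S *m H)) (linearB (row i)) (linearB (row i)) /=.
by rewrite exact_part linear_part.
Qed.

Lemma udiag_taylor_le S T d e d' e' (G Gd : 'I_n -> 'I_n -> C) (delta : C)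
    (H := udiag T e - udiag S d) :
  S \is unitarymx -> T \is unitarymx ->
  (forall i j, e' j - d' i = G i j * (e j - d i)) -> 0 <= delta ->
  (forall i, `|udiag T (G i) - udiag S (Gd i)| <= delta) ->
  `|udiag T e' - udiag S d' - sandwich S Gd H| <=
  n%:R ^+ 3 * delta * `|H|.
Proof.
move=> uS uT GE delta0 le_delta; have taylor := udiag_taylor Gd uS uT GE.
move: (udiag T e' - _ - _) taylor => M taylor.
have -> : M = S^t* *m (S *m M) by rewrite mulmxA unitary_mulVl // mul1mx.
apply: le_trans (mx_normM_unitaryl _ _) _; first by rewrite trmxC_unitary.
(* The three factors [n] come from removing [S^t*], from the matrix product and from [S *m H]. *)
rewrite exprS -!mulrA ler_wpM2l //.
apply: mx_norm_le => [|i j]; first by rewrite !mulr_ge0 ?exprn_ge0.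
have -> : (S *m M) i j = (S *m H *m (udiag T (G i) - udiag S (Gd i))) i j.
  by have /rowP/(_ j) := taylor i; rewrite mxE [RHS]mxE.
apply: le_trans (mx_entry_le _ _ _) _; apply: le_trans (mx_normM _ _) _.
rewrite ler_wpM2l // (mulrC delta) mulrA ler_pM //.
exact: mx_normM_unitaryl.
Qed.

End Perturbation.

(** * Equality case of the trace Hölder inequality *)

Section HolderEquality.
Local Open Scope sesquilinear_scope.
Context {C : numClosedFieldType} {n : nat}.
Implicit Types (S T U W Z X : 'M[C]_n) (s a b l Y : 'I_n -> C).

Lemma gram_diagE Z k : (Z^t* *m Z) k k = \sum_i `|Z i k| ^+ 2.
Proof. by rewrite mxE; apply: eq_bigr => i _; rewrite !mxE normCK mulrC. Qed.

(* [Z] has orthogonal columns of norms [s k]; normalizing them (a zero column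
   stays zero because [0^-1 = 0]) gives a partial isometry, hence Bessel. *)
Lemma normalized_columns Z s (U := Z *m dgmx (fun k => (s k)^-1)) :
  (forall k, 0 <= s k) -> Z^t* *m Z = dgmx (fun k => s k ^+ 2) ->
  [/\ forall i k, Z i k = U i k * s k,
      forall k, \sum_i `|U i k| ^+ 2 <= 1 &
      forall i, \sum_k `|U i k| ^+ 2 <= 1].
Proof.
move=> s0 ZZ.
have sVreal k : (s k)^-1 \is Num.real by rewrite ger0_real // invr_ge0.
have UU : U^t* *m U = dgmx (fun k => (s k != 0)%:R).
  rewrite /U trmx_mul map_mxM dgmx_adj // !mulmxA -(mulmxA _ _ Z) ZZ !mul_dgmx.
  congr dgmx; apply/funext => k.
  have [->|sk] := eqVneq (s k) 0; first by rewrite invr0 mulr0.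
  by rewrite expr2 mulKf // mulfV.
have Usupp i k : U i k * (s k != 0)%:R = U i k.
  rewrite /U mul_mx_dgmxE; have [->|_] := eqVneq (s k) 0; last by rewrite mulr1.
  by rewrite invr0 !mulr0.
split=> [i k|k|i].
- rewrite /U mul_mx_dgmxE; have [sk|sk] := eqVneq (s k) 0; last by rewrite mulfVK.
  have : (Z^t* *m Z) k k = 0 by rewrite ZZ !mxE sk expr0n mul0rn.
  rewrite gram_diagE => /eqP; rewrite psumr_eq0 => [|j _]; last exact: exprn_ge0.
  move/allP/(_ i (mem_index_enum i)); rewrite expf_eq0 normr_eq0 /= => /eqP->.
  by rewrite !mul0r.
- by rewrite -gram_diagE UU !mxE eqxx mulr1n; case: eqP.
(* The row sums are the diagonal entries of the projection [Q]; since [Q i i] is the squared norm of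
   the [i]-th column of [Q], it dominates its own square. *)
set Q := U *m U^t*.
have QQ : Q *m Q = Q.
  rewrite /Q mulmxA -(mulmxA U) UU; congr (_ *m _).
  by apply/matrixP => j k; rewrite mul_mx_dgmxE Usupp.
have Qadj : Q^t* = Q by rewrite /Q trmx_mul map_mxM trmxCK.
have Qii : Q i i = \sum_k `|U i k| ^+ 2.
  by rewrite mxE; apply: eq_bigr => k _; rewrite !mxE normCK.
have Qii0 : 0 <= Q i i by rewrite Qii sumr_ge0 // => k _; rewrite exprn_ge0.
have : Q i i ^+ 2 <= Q i i.
  rewrite -{2}QQ -{2}Qadj gram_diagE (bigD1 i) //= ger0_norm // lerDl.
  by apply: sumr_ge0 => k _; rewrite exprn_ge0.
rewrite -Qii; have [->|Q0] := eqVneq (Q i i) 0; first by rewrite ler01.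
by rewrite expr2 ger_pMr // lt0r Q0.
Qed.

Lemma unitary_col_norm X k : X \is unitarymx -> \sum_i `|X i k| ^+ 2 = 1.
Proof.
by move=> uX; rewrite -gram_diagE unitary_mulVl // mxE eqxx.
Qed.

Lemma weighted_sum_le (D : 'I_n -> 'I_n -> C) (c : 'I_n -> C) :
  (forall i, 0 <= c i) -> (forall i, \sum_k D i k <= 1) ->
  \sum_i \sum_k c i * D i k <= \sum_i c i.
Proof.
move=> c0 D1; apply: ler_sum => i _.
by rewrite -mulr_sumr ler_piMr.
Qed.

(** In the bases of [S] and [T] the trace is a sum of [a i * s k] against products of entries of a
    partial isometry [U] and a unitary [X]. Bounding these products by the doubly substochastic
    weights [D] and applying Young's inequality termwise gives at most [p + p' = 1]. As the trace
    equals 1, every inequality used is an equality. *)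
Lemma trace_holder_eq S T W a b l s Y (p p' : C) :
  S \is unitarymx -> T \is unitarymx ->
  (forall i, 0 < a i) -> (forall i, 0 < b i) -> (forall k, 0 <= s k) ->
  (forall i, 0 <= l i) -> (forall k, 0 <= Y k) -> 0 <= p -> 0 <= p' -> p + p' = 1 ->
  W^t* *m W = udiag T (fun k => s k ^+ 2) ->
  \sum_i l i = 1 -> \sum_k Y k = 1 ->
  (forall i k, a i * s k <= p * l i + p' * Y k) ->
  (forall i k, a i * s k = p * l i + p' * Y k -> s k = b i) ->
  \tr (udiag S a *m W) = 1 -> W = udiag S b.
Proof.
move=> uS uT a0 b0 s0 l0 Y0 p0 p'0 pp' WW suml sumY young young_eq trW.
pose X := S *m T^t*; pose Z := S *m W *m T^t*.
have uX : X \is unitarymx by rewrite mul_unitarymx // trmxC_unitary.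
have ZZ : Z^t* *m Z = dgmx (fun k => s k ^+ 2).
  rewrite /Z !trmx_mul !map_mxM trmxCK !mulmxA -(mulmxA _ (S^t*)) unitary_mulVl //.
  rewrite mulmx1 -(mulmxA T) WW -(mulmxA T) mulmx_udiagr // mulmxA.
  by rewrite unitary_mulV // mul1mx.
have [] := normalized_columns s0 ZZ.
set U := Z *m _ => ZE colU rowU.
pose D i k := (`|U i k| ^+ 2 + `|X i k| ^+ 2) / 2.
have D0 i k : 0 <= D i k by rewrite divr_ge0 ?addr_ge0 ?exprn_ge0.
have rowD i : \sum_k D i k <= 1.
  rewrite -mulr_suml big_split /= ler_pdivrMr // mul1r (unitary_row_norm i uX).
  by rewrite (natrD _ 1 1) lerD.
have colD k : \sum_i D i k <= 1.
  rewrite -mulr_suml big_split /= ler_pdivrMr // mul1r (unitary_col_norm k uX).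
  by rewrite (natrD _ 1 1) lerD.
have as0 i k : 0 <= a i * s k by rewrite mulr_ge0 // ltW.
have trE : \sum_i \sum_k a i * s k * (U i k * (X i k)^*) = 1.
  have SWS : S *m W *m S^t* = Z *m X^t*.
    by rewrite /Z /X trmx_mul map_mxM trmxCK mulmxA mulmxKtV.
  rewrite -trW /udiag -!mulmxA mxtrace_mulC -!mulmxA (mulmxA S) SWS.
  rewrite /mxtrace; apply: eq_bigr => i _; rewrite mul_dgmxE mxE mulr_sumr.
  apply: eq_bigr => k _; have -> : (X^t*) k i = (X i k)^* by rewrite !mxE.
  by rewrite ZE; ring.
(* The conjugate of [trE]; averaging the two produces the real part needed to complete the square of
   [U i k - X i k]. *)
have trE' : \sum_i \sum_k a i * s k * ((U i k)^* * X i k) = 1.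
  rewrite -[RHS]conjC1 -trE rmorph_sum; apply: eq_bigr => i _.
  rewrite rmorph_sum; apply: eq_bigr => k _.
  by rewrite rmorphM /= (geC0_conj (as0 i k)) rmorphM /= conjCK.
have sumD : \sum_i \sum_k (p * l i + p' * Y k) * D i k <= 1.
  have -> : \sum_i \sum_k (p * l i + p' * Y k) * D i k =
      p * (\sum_i \sum_k l i * D i k) + p' * (\sum_k \sum_i Y k * D i k).
    rewrite [X in p' * X]exchange_big !mulr_sumr -big_split; apply: eq_bigr => i _.
    rewrite !mulr_sumr -big_split; apply: eq_bigr => k _.
    by rewrite mulrDl !mulrA.
  rewrite -pp' -[X in _ <= X + _]mulr1 -[X in _ <= _ + X]mulr1.
  apply: lerD; apply: ler_wpM2l => //; first by rewrite -suml weighted_sum_le.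
  by rewrite -sumY (weighted_sum_le (D := fun k i => D i k)).
(* [gap] is the loss in bounding the real part by [D], [slack] the loss in Young's inequality. Both
   are nonnegative and their total is at most 0. *)
pose gap i k := a i * s k * `|U i k - X i k| ^+ 2 / 2.
pose slack i k := (p * l i + p' * Y k - a i * s k) * D i k.
have gap0 i k : 0 <= gap i k by rewrite divr_ge0 // mulr_ge0 ?exprn_ge0.
have slack0 i k : 0 <= slack i k by rewrite mulr_ge0 // subr_ge0.
have sum0 : \sum_i \sum_k (gap i k + slack i k) <= 0.
  have -> : \sum_i \sum_k (gap i k + slack i k) =
     \sum_i \sum_k (p * l i + p' * Y k) * D i k -
     (\sum_i \sum_k a i * s k * (U i k * (X i k)^*) +
      \sum_i \sum_k a i * s k * ((U i k)^* * X i k)) / 2.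
    rewrite -big_split mulr_suml -sumrB; apply: eq_bigr => i _.
    rewrite -big_split mulr_suml -sumrB; apply: eq_bigr => k _.
    rewrite /gap /slack /D /= !normCK rmorphB /=.
    move: (a i) (s k) (p * l i) (p' * Y k) (U i k) (U i k)^* (X i k) (X i k)^*.
    by move=> *; field.
  by rewrite trE trE' divff // subr_le0.
have terms0 i k : gap i k = 0 /\ slack i k = 0.
  have : \sum_i \sum_k (gap i k + slack i k) == 0.
    rewrite eq_le sum0; apply: sumr_ge0 => j _; apply: sumr_ge0 => m _.
    exact: addr_ge0.
  rewrite psumr_eq0 => [/allP/(_ i (mem_index_enum i)) /=|j _]; last first.
    by apply: sumr_ge0 => m _; apply: addr_ge0.
  rewrite psumr_eq0 => [/allP/(_ k (mem_index_enum k)) /=|m _]; last exact: addr_ge0.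
  by rewrite paddr_eq0 // => /andP[/eqP-> /eqP->].
(* Either Young's inequality is tight, so that [s k = b i] and the vanishing gap forces
   [U i k = X i k], or [D i k = 0] and both entries vanish. *)
have ZbX i k : Z i k = b i * X i k.
  have [/eqP gapE /eqP] := terms0 i k.
  rewrite mulf_eq0 subr_eq0 eq_sym.
  case/orP => [/eqP young_tight|].
    have sb : s k = b i by apply: young_eq.
    move: gapE; rewrite mulf_eq0 invr_eq0 pnatr_eq0 orbF mulf_eq0 sb.
    rewrite (gt_eqF (mulr_gt0 (a0 i) (b0 i))) /= expf_eq0 /= normr_eq0 subr_eq0.
    by rewrite ZE sb mulrC => /eqP->.
  rewrite mulf_eq0 invr_eq0 pnatr_eq0 orbF paddr_eq0 ?exprn_ge0 //.
  rewrite !expf_eq0 !normr_eq0 /= => /andP[/eqP U0 /eqP X0].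
  by rewrite ZE U0 X0 mul0r mulr0.
have ZE' : Z = dgmx b *m X by apply/matrixP => i k; rewrite mul_dgmxE ZbX.
have -> : W = S^t* *m Z *m T.
  by rewrite /Z !mulmxA unitary_mulVl // mul1mx mulmxKtV.
by rewrite ZE' /X /udiag !mulmxA mulmxKtV.
Qed.

End HolderEquality.

(** * Schur multipliers under the trace and on commutators *)

Section SandwichTrace.
Local Open Scope sesquilinear_scope.
Context {C : numClosedFieldType} {n : nat}.
Implicit Types (A B S : 'M[C]_n) (d e : 'I_n -> C).
Lemma tr_mul_sandwich S A B c : S \is unitarymx ->
  \tr (A *m sandwich S c B) =
  \sum_i \sum_j (S *m A *m S^t*) i j * (c j i * (S *m B *m S^t*) j i).
Proof.
move=> uS; rewrite /sandwich mulmxA mxtrace_mulC !mulmxA /mxtrace.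
by apply: eq_bigr => i _; rewrite mxE; apply: eq_bigr => j _; rewrite [X in _ * X]mxE.
Qed.

Lemma sandwich_conjE S c B : S \is unitarymx ->
  S *m sandwich S c B *m S^t* = \matrix_(i, j) (c i j * (S *m B *m S^t*) i j).
Proof.
by move=> uS; rewrite /sandwich !mulmxA unitary_mulV // mul1mx mulmxtVK.
Qed.

(** The trace pairs entry [(i, j)] of one factor with entry [(j, i)] of the other, whence the
    transposed indices in the condition on the symbols. *)
Lemma tr_sandwich_mul S A B c c' c'' (k : C) : S \is unitarymx ->
  (forall i j, c i j * c' j i = k * c'' j i) ->
  \tr (sandwich S c A *m sandwich S c' B) = k * \tr (A *m sandwich S c'' B).
Proof.
move=> uS cE; rewrite !tr_mul_sandwich // sandwich_conjE // mulr_sumr.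
apply: eq_bigr => i _; rewrite mulr_sumr; apply: eq_bigr => j _.
by rewrite mxE mulrACA cE; ring.
Qed.

(** In the eigenbasis the commutator has entries [d i - d j] times those of [B]; a divided
    difference as symbol replaces the factor by [e i - e j]. *)
Lemma sandwich_commutator S c d e a B : S \is unitarymx ->
  (forall i j, c i j * (d i - d j) = e i - e j) ->
  sandwich S c (a *: (udiag S d *m B - B *m udiag S d)) =
  a *: (udiag S e *m B - B *m udiag S e).
Proof.
move=> uS cde.
have conjE f : S *m (udiag S f *m B - B *m udiag S f) *m S^t* =
    dgmx f *m (S *m B *m S^t*) - S *m B *m S^t* *m dgmx f.
  rewrite mulmxBr mulmxBl (mulmxA S (udiag S f)) (mulmx_udiagl f uS).
  by rewrite -(mulmxA S (B *m _)) -(mulmxA B) (mulmx_udiagr f uS) !mulmxA.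
set M := udiag S e *m B - B *m udiag S e.
have -> : a *: M = S^t* *m (a *: (S *m M *m S^t*)) *m S.
  rewrite -scalemxAr -scalemxAl; congr (_ *: _).
  by rewrite !mulmxA unitary_mulVl // mul1mx mulmxKtV.
rewrite /sandwich /M conjE; congr (_ *m _ *m _).
rewrite -scalemxAr -scalemxAl conjE; move: (S *m B *m S^t*) => K.
apply/matrixP => i j; rewrite mxE.
have entry f : (a *: (dgmx f *m K - K *m dgmx f)) i j = a * ((f i - f j) * K i j).
  have -> (P Q : 'M[C]_n) : (a *: (P - Q)) i j = a * (P i j - Q i j) by rewrite !mxE.
  by rewrite mul_dgmxE mul_mx_dgmxE; ring.
by rewrite !entry -cde; ring.
Qed.

Lemma commutator_herm A B : A \is hermsymmx -> B \is hermsymmx ->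
  'i *: (A *m B - B *m A) \is hermsymmx.
Proof.
move=> /hermsymmxP hA /hermsymmxP hB; apply/hermsymmxP.
rewrite linearZ /= map_mxZ /= conjCi linearB /= map_mxB !trmx_mul !map_mxM /=.
by rewrite hA hB scaleNr -scalerN opprB.
Qed.

End SandwichTrace.

(** * Real functional calculus *)

Section RealSpectralCalculus.
Local Open Scope sesquilinear_scope.
Local Open Scope complex_scope.
Context {R : realType} {n : nat}.
Implicit Types (A B : 'M[R[i]]_n) (f : R -> R).

Lemma real_complex_real (x : R) : x%:C \is Num.real.
Proof. by apply/complex_realP; exists x. Qed.

Lemma norm_real_complex (x : R) : `|x%:C| = `|x|%:C.
Proof. by rewrite normc_def /= expr0n addr0 sqrtr_sqr. Qed.

Lemma mxfunE f A :
  mxfun f A = udiag (spectralmx A) (fun i => (f (eigval A i))%:C).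
Proof. exact: eigproj_sum (spectral_unitarymx A). Qed.

Lemma mxfunLRE (c : R -> R -> R) A B : mxfunLR c A B =
  sandwich (spectralmx A) (fun i j => (c (eigval A i) (eigval A j))%:C) B.
Proof.
exact: (spectral_sandwichE (fun i j => (c (eigval A i) (eigval A j))%:C) B
  (spectral_unitarymx A)).
Qed.

Lemma eigvalE A i : A \is hermsymmx -> (eigval A i)%:C = spectral_diag A 0 i.
Proof. by move=> hA; apply/RRe_real/spectral_diag_real. Qed.

Lemma hermitian_eigval A : A \is hermsymmx ->
  A = udiag (spectralmx A) (fun i => (eigval A i)%:C).
Proof.
move=> hA; rewrite {1}(hermitian_spectral hA); congr udiag.
by apply/funext => i; rewrite eigvalE.
Qed.

Lemma mxfun_udiag f (V : 'M[R[i]]_n) (d : 'I_n -> R) : V \is unitarymx ->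
  mxfun f (udiag V (fun i => (d i)%:C)) = udiag V (fun i => (f (d i))%:C).
Proof.
move=> uV; rewrite mxfunE.
set A := udiag V _.
have hA : A \is hermsymmx by apply: udiag_herm => i; apply: real_complex_real.
have transfer i j : (eigval A j)%:C = (d i)%:C ->
    (f (eigval A j))%:C = (f (d i))%:C by case=> ->.
have := udiag_transfer uV (spectral_unitarymx A) transfer.
by apply; rewrite -hermitian_eigval.
Qed.

Lemma eigval_gt0 A i : strictly_positive A -> 0 < eigval A i.
Proof.
move=> [hA pA]; rewrite -ltcR eigvalE //; exact: spectral_diag_gt0.
Qed.

Lemma mxfunLR_linear (c : R -> R -> R) A (a : R[i]) B B' :
  mxfunLR c A (a *: B + B') = a *: mxfunLR c A B + mxfunLR c A B'.
Proof.
by rewrite !mxfunLRE sandwich_linear.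
Qed.

End RealSpectralCalculus.

(** * Divided differences of powers *)

Section DividedDifference.
Local Open Scope sesquilinear_scope.
Local Open Scope complex_scope.
Context {R : realType}.
Implicit Types (f g : R -> R) (x y t r : R).

Definition divdiff f (f' : R -> R) x y : R :=
  if x == y then f' x else (f x - f y) / (x - y).

Lemma divdiff_mul f f' x y : divdiff f f' x y * (y - x) = f y - f x.
Proof.
rewrite /divdiff; have [->|xy] := eqVneq x y; first by rewrite !subrr mulr0.
by rewrite -(opprB x) mulrN mulfVK ?subr_eq0 // opprB.
Qed.

(* Continuity of [g] at [y] together with at most linear growth on the
   half-line: this one inequality controls functional calculus without
   tracking how the eigenvalues move. *)
Definition tame_at g y : Prop := forall eps, 0 < eps ->
  exists2 K, 0 <= K & forall t, 0 < t -> `|g t - g y| <= eps + K * `|t - y|.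

(** Within [delta] of [y] continuity suffices; farther away the bound [M + M] is absorbed by the
    linear term with slope [(M + M) / delta]. *)
Lemma bounded_continuous_tame g y M : 0 < y ->
  (forall t, 0 < t -> `|g t| <= M) ->
  (forall eps, 0 < eps -> exists2 delta, 0 < delta &
     forall t, `|t - y| < delta -> `|g t - g y| <= eps) ->
  tame_at g y.
Proof.
move=> y0 gM gc eps eps0; have [delta delta0 gdelta] := gc eps eps0.
have M0 : 0 <= M by apply: le_trans (gM y y0).
have K0 : 0 <= (M + M) / delta by rewrite divr_ge0 ?addr_ge0 // ltW.
exists ((M + M) / delta) => // t t0.
have [/gdelta gt|dt] := ltP `|t - y| delta.
  by apply: le_trans gt _; rewrite lerDl mulr_ge0.
apply: le_trans (ler_normB _ _) _; apply: le_trans (lerD (gM t t0) (gM y y0)) _.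
apply: (@le_trans _ _ ((M + M) / delta * `|t - y|)); last by rewrite lerDr ltW.
by rewrite mulrAC ler_pdivlMr // ler_wpM2l ?addr_ge0.
Qed.

Lemma powR_dist_le x t r : 0 < r <= 1 -> 0 < x -> 0 < t ->
  `|t `^ r - x `^ r| <= x `^ (r - 1) * `|t - x|.
Proof.
move=> /andP[r0 r1] x0 t0; have u0 : 0 < t / x by rewrite divr_gt0.
have -> : t = t / x * x by rewrite mulfVK ?gt_eqF.
move: (t / x) u0 => u u0.
have one_powR : 1 `^ r = 1 by rewrite powR1.
have factor (a b : R) : a * b - b = (a - 1) * b by rewrite mulrBl mul1r.
rewrite powRM ?(ltW u0) ?(ltW x0) // !factor !normrM.
rewrite (gtr0_norm (powR_gt0 _ x0)) (gtr0_norm x0) mulrCA.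
rewrite (_ : x `^ (r - 1) * x = x `^ r); last first.
  by rewrite mulrC mulr_powRB1 // ltW.
rewrite ler_wpM2r ?powR_ge0 //.
have [u1|/ltW u1] := leP u 1.
  have /andP[uu uu1] : u <= u `^ r <= 1.
    rewrite ger1_powR ?u0 //= -[leRHS]one_powR ge0_ler_powR ?nnegrE ?(ltW u0) //.
    exact: ltW.
  by rewrite !ler0_norm ?subr_le0 // lerN2 lerD2r.
have /andP[uu uu1] : 1 <= u `^ r <= u.
  by rewrite ler1_powR // andbT -[leLHS]one_powR ge0_ler_powR ?nnegrE ?(ltW u0) // ltW.
by rewrite !ger0_norm ?subr_ge0 // lerD2r.
Qed.

Lemma divdiff_powR_bound x t r : 0 < r <= 1 -> 0 < x -> 0 < t ->
  `|divdiff (@powR R ^~ r) (fun z => r * z `^ (r - 1)) x t| <= x `^ (r - 1).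
Proof.
move=> r01 x0 t0; rewrite /divdiff; have [_|xt] := eqVneq x t.
  case/andP: r01 => r0 r1; rewrite normrM gtr0_norm // ger0_norm ?powR_ge0 //.
  by rewrite ler_piMl ?powR_ge0.
rewrite normrM normfV ler_pdivrMr ?normr_gt0 ?subr_eq0 //.
by rewrite distrC (distrC x) powR_dist_le.
Qed.

(** At [y = x] this is the existence of the derivative; elsewhere it is the continuity of a
    quotient. *)
Lemma divdiff_powR_cont x y r (eps : R) : 0 < x -> 0 < y -> 0 < eps ->
  exists2 delta, 0 < delta & forall t, `|t - y| < delta ->
  `|divdiff (@powR R ^~ r) (fun z => r * z `^ (r - 1)) x t -
    divdiff (@powR R ^~ r) (fun z => r * z `^ (r - 1)) x y| <= eps.
Proof.
move=> x0 y0 eps0; have [<-|xy] := eqVneq x y.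
  have [dv Ev] := is_derive1_powR r x0.
  have : h^-1 *: (((@powR R ^~ r) \o shift x) (h *: (1 : R)) - x `^ r) @[h --> 0^'] -->
      r * x `^ (r - 1) by rewrite -Ev; exact: dv.
  move=> /cvgrPdist_le/(_ eps eps0) /nbhs_ballP[delta /= delta0 Hd].
  exists delta => // t xt; rewrite /divdiff eqxx.
  have [_|nxt] := eqVneq x t; first by rewrite subrr normr0 ltW.
  have := Hd (t - x); rewrite -ball_normE /ball_ /= sub0r normrN => /(_ xt).
  rewrite subr_eq0 eq_sym => /(_ nxt).
  rewrite /shift /= [_ *: 1]mulr1 subrK distrC.
  by rewrite -(opprB x) -(opprB (x `^ r)) invrN scaleNr scalerN opprK [_ *: _]mulrC.
have yx0 : x - y != 0 by rewrite subr_eq0.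
have cy : (x `^ r - t `^ r) / (x - t) @[t --> y] --> (x `^ r - y `^ r) / (x - y).
  apply: cvgM.
    apply: cvgB; first exact: cvg_cst.
    have [dv _] := is_derive1_powR r y0.
    have : {for y, continuous (@powR R ^~ r)}.
      by apply: differentiable_continuous; apply/derivable1_diffP.
    exact.
  by apply: cvgV => //; apply: cvgB; [exact: cvg_cst | exact: cvg_id].
have /cvgrPdist_le/(_ eps eps0) /nbhs_ballP[delta /= delta0 Hd] := cy.
(* The bound by the distance from [x] to [y] keeps [t] away from [x], where the divided difference
   changes formula. *)
exists (Num.min delta `|x - y|) => [|t]; first by rewrite lt_min delta0 normr_gt0.
rewrite lt_min => /andP[td txy]; rewrite /divdiff (negPf xy).
have [xt|_] := eqVneq x t; first by rewrite xt ltxx in txy.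
by rewrite distrC; apply: Hd; rewrite -ball_normE /ball_ /= distrC.
Qed.

Lemma divdiff_powR_tame x y r : 0 < r <= 1 -> 0 < x -> 0 < y ->
  tame_at (divdiff (@powR R ^~ r) (fun z => r * z `^ (r - 1)) x) y.
Proof.
move=> r01 x0 y0; apply: bounded_continuous_tame => //.
  by move=> t; apply: divdiff_powR_bound r01 x0.
by move=> eps eps0; apply: divdiff_powR_cont.
Qed.

End DividedDifference.

(** * Differentials on the density manifold *)

Section Differential.
Local Open Scope sesquilinear_scope.
Local Open Scope complex_scope.
Context {R : realType} {n : nat}.
Implicit Types (rho A B x : 'M[R[i]]_n) (F L : 'M[R[i]]_n -> 'M[R[i]]_n).

Lemma near_norm_lt rho (e : R[i]) : 0 < e -> \forall x \near rho, `|x - rho| < e.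
Proof.
move=> e0; have := nbhsx_ballx rho e e0.
by rewrite mx_norm_ball; apply: filterS => x /=; rewrite distrC.
Qed.

Lemma is_differentialP F rho L : is_differential F rho L <->
  (forall (a : R) A B, tangent A -> tangent B ->
     L (a%:C *: A + B) = a%:C *: L A + L B) /\
  (forall eps : R[i], 0 < eps -> \forall x \near rho, density x ->
     `|F x - (F rho + L (x - rho))| <= eps * `|x - rho|).
Proof.
split=> -[linL FL]; split => //.
  have /eqaddoP FLo := funext FL.
  by move=> eps eps0; apply: FLo.
move=> x; rewrite littleoE; last by move=> eps eps0; apply: FL.
by rewrite /= addrC subrK.
Qed.

End Differential.

(** * Continuity of the functional calculus at a density matrix *)

Section DifferentialMxfun.
Local Open Scope sesquilinear_scope.
Local Open Scope complex_scope.
Context {R : realType} {n : nat}.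
Implicit Types (rho A B x : 'M[R[i]]_n) (f g : R -> R).

(** The order of choices matters: tameness yields [K] only after [eps] is fixed, and the radius
    [eta] may then depend on [K]. *)
Lemma modulus_exists (e a : R[i]) : 0 < e -> 0 <= a ->
  exists2 eps : R, 0 < eps & forall K, 0 <= K ->
  exists2 eta : R[i], 0 < eta &
    forall h, 0 <= h -> h < eta -> a * (eps%:C + K * (a * h)) <= e.
Proof.
move=> e0 a0; have a1 : 0 < a + 1 by rewrite ltr_wpDl.
have e2 : 0 < e / 2 by rewrite divr_gt0.
have eps0 : 0 < e / 2 / (a + 1) by rewrite divr_gt0.
have /complex_realP[eps epsE] := gtr0_real eps0.
exists eps => [|K K0]; first by rewrite -ltcR -epsE.
have b1 : 0 < a * K * a + 1 by rewrite ltr_wpDl ?mulr_ge0.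
exists (e / 2 / (a * K * a + 1)); first by rewrite divr_gt0.
move=> h h0; rewrite ltr_pdivlMr // => hb.
rewrite -epsE mulrDr [leRHS](splitr e) lerD //.
  by rewrite mulrA ler_pdivrMr // mulrDr mulr1 mulrC lerDl ltW.
by apply: le_trans (ltW hb); rewrite mulrDr mulr1 !mulrA [leRHS]addrC mulrC !mulrA lerDr.
Qed.

Lemma mxfun_continuous g rho (e : R[i]) : density rho ->
  (forall i, tame_at g (eigval rho i)) -> 0 < e ->
  \forall x \near rho, density x -> `|mxfun g x - mxfun g rho| <= e.
Proof.
move=> drho tame_g e0; have [hrho _] := drho.1.
have n0 : 0 <= n%:R ^+ 2 :> R[i] by rewrite exprn_ge0.
have [eps eps0 modulus] := modulus_exists e0 n0.
(* One slope per eigenvalue of [rho]; their sum serves for all of them. *)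
have /fin_all_exists2[K K0 HK] := fun i => tame_g i eps eps0.
have sumK0 : 0 <= (\sum_i K i)%:C by rewrite ler0c sumr_ge0.
have [eta eta0 Heta] := modulus _ sumK0.
apply: filterS (near_norm_lt rho eta0) => x xrho dx.
have [hx _] := dx.1.
apply: le_trans (Heta _ (normr_ge0 _) xrho).
have := @udiag_dist_le _ _ (spectralmx rho) (spectralmx x)
  (fun i => (eigval rho i)%:C) (fun i => (eigval x i)%:C)
  (fun i => (g (eigval rho i))%:C) (fun i => (g (eigval x i))%:C)
  eps%:C (\sum_i K i)%:C (spectral_unitarymx _) (spectral_unitarymx _).
rewrite -!mxfunE -!hermitian_eigval //; apply => //; first by rewrite ler0c ltW.
move=> i j; rewrite -!rmorphB /= !norm_real_complex -rmorphM -rmorphD lecR.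
apply: le_trans (HK i _ (eigval_gt0 j dx.1)) _.
rewrite lerD2l ler_wpM2r // (bigD1 i) //= lerDl sumr_ge0 //.
Qed.

End DifferentialMxfun.

(** * Differentiability of the functional calculus and uniqueness of differentials *)

Section DifferentialAmari.
Local Open Scope sesquilinear_scope.
Local Open Scope complex_scope.
Context {R : realType} {n : nat}.
Implicit Types (rho A B x : 'M[R[i]]_n) (f : R -> R).
Implicit Types (F L : 'M[R[i]]_n -> 'M[R[i]]_n).

Lemma is_differential_mxfun f f' rho : density rho ->
  (forall y z, 0 < y -> 0 < z -> tame_at (divdiff f f' y) z) ->
  is_differential (mxfun f) rho (mxfunLR (divdiff f f') rho).
Proof.
move=> drho tame_f; have [hrho _] := drho.1.
apply/is_differentialP; split=> [a A B _ _|e e0]; first exact: mxfunLR_linear.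
have n0 : 0 < n%:R ^+ 3 + 1 :> R[i] by rewrite ltr_wpDl ?exprn_ge0.
pose delta := e / (n%:R ^+ 3 + 1).
have delta0 : 0 < delta by rewrite divr_gt0.
(* One continuity statement for each eigenvalue of [rho], applied to the divided difference there;
   finitely many neighbourhoods are then intersected. *)
have near_i i : \forall x \near rho, density x ->
    `|mxfun (divdiff f f' (eigval rho i)) x -
      mxfun (divdiff f f' (eigval rho i)) rho| <= delta.
  apply: (mxfun_continuous drho _ delta0) => j.
  by apply: tame_f; apply: eigval_gt0 drho.1.
have near_all := @filter_forall _ _ _ _ (nbhs_filter rho) near_i.
apply: (@filterS _ _ (nbhs_filter rho) _ _ _ near_all) => x near_x dx.
have [hx _] := dx.1.
have := @udiag_taylor_le _ _ (spectralmx rho) (spectralmx x)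
  (fun i => (eigval rho i)%:C) (fun i => (eigval x i)%:C)
  (fun i => (f (eigval rho i))%:C) (fun i => (f (eigval x i))%:C)
  (fun i j => (divdiff f f' (eigval rho i) (eigval x j))%:C)
  (fun i j => (divdiff f f' (eigval rho i) (eigval rho j))%:C)
  delta (spectral_unitarymx _) (spectral_unitarymx _).
rewrite -!hermitian_eigval // -!mxfunE -mxfunLRE opprD addrA.
move=> taylor; apply: le_trans (taylor _ (ltW delta0) _) _.
- by move=> i j; rewrite -!rmorphB -rmorphM /= divdiff_mul.
- by move=> i; rewrite -!mxfunE; apply: near_x.
rewrite ler_wpM2r // /delta mulrA ler_pdivrMr // mulrC ler_wpM2l ?(ltW e0) //.
by rewrite lerDl.
Qed.

Lemma is_differentialZ (c : R) F rho L : is_differential F rho L ->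
  is_differential (fun x => c%:C *: F x) rho (fun B => c%:C *: L B).
Proof.
move=> /is_differentialP[linL FL]; apply/is_differentialP; split=> [a A B tA tB|e e0].
  by rewrite linL // scalerDr !scalerA mulrC.
have c1 : 0 < `|c%:C| + 1 by rewrite ltr_wpDl.
apply: filterS (FL (e / (`|c%:C| + 1)) (divr_gt0 e0 c1)) => x near_x /near_x {}near_x.
rewrite -scalerDr -scalerBr mx_normZ.
apply: le_trans (ler_wpM2l (normr_ge0 _) near_x) _.
rewrite mulrA ler_wpM2r // mulrA ler_pdivrMr // mulrC ler_wpM2l ?(ltW e0) //.
by rewrite lerDl.
Qed.

Lemma eq_is_differential F G rho L : density rho ->
  (forall x, density x -> F x = G x) ->
  is_differential F rho L -> is_differential G rho L.
Proof.
move=> drho FG /is_differentialP[linL FL]; apply/is_differentialP; split=> // e e0.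
by apply: filterS (FL e e0) => x near_x dx; rewrite -!FG //; apply: near_x.
Qed.

(** The summand 1 in the witness keeps it positive when [n = 0]. *)
Lemma positive_lower_bound (d : 'I_n -> R) : (forall i, 0 < d i) ->
  exists2 m : R, 0 < m & forall i, m <= d i.
Proof.
move=> d0; have s0 : 0 <= \sum_i (d i)^-1.
  by rewrite sumr_ge0 // => i _; rewrite invr_ge0 ltW.
exists (1 + \sum_i (d i)^-1)^-1 => [|i]; first by rewrite invr_gt0 ltr_wpDr.
rewrite -[leRHS]invrK lef_pV2 ?posrE ?invr_gt0 ?ltr_wpDr //.
rewrite (bigD1 i) //= addrCA lerDl addr_ge0 // sumr_ge0 // => j _.
by rewrite invr_ge0 ltW.
Qed.

(** Openness in tangent directions: with [m] below the spectrum of [A] and [a] bounding that of [B]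
    in modulus, [t * (1 + a) < m] preserves positivity. *)
Lemma density_segment A B : density A -> tangent B ->
  exists2 t0 : R, 0 < t0 & forall t, 0 < t < t0 -> density (A + t%:C *: B).
Proof.
move=> [pA trA] [hB trB]; have [hA _] := pA.
have [m m0 mle] := positive_lower_bound (fun i => eigval_gt0 i pA).
pose a := \sum_i `|eigval B i|.
have a0 : 0 <= a by apply: sumr_ge0.
have ale i : - a <= eigval B i.
  rewrite lerNl (le_trans (ler_norm _)) // normrN /a (bigD1 i) //= lerDl.
  exact: sumr_ge0.
exists (m / (1 + a)) => [|t /andP[t0]]; first by rewrite divr_gt0 ?ltr_wpDr.
rewrite ltr_pdivlMr ?ltr_wpDr // => tm; split; last first.
  by rewrite mxtraceD mxtraceZ trA trB mulr0 addr0.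
split=> [|v v0].
  apply/hermsymmxP; rewrite linearD /= map_mxD (adjmxZ _ (real_complex_real t)).
  by rewrite (hermsymmxP _ hA) (hermsymmxP _ hB).
apply: (@hermitian_form_pos _ _ _ _ m%:C a%:C t%:C) => // [i|i||].
- by rewrite -eigvalE // lecR.
- by rewrite -eigvalE // -rmorphN lecR.
- by rewrite ler0c ltW.
rewrite -rmorphM ltcR; apply: le_lt_trans tm.
by rewrite mulrDr mulr1 lerDr ltW.
Qed.

Lemma density_near A B : density A -> tangent B ->
  forall P : set 'M[R[i]]_n, (\forall x \near A, P x) ->
  exists t : R, [/\ 0 < t, density (A + t%:C *: B) & P (A + t%:C *: B)].
Proof.
move=> dA tB P /nbhs_ballP[delta /= delta0 HP].
have [s s0 segment] := density_segment dA tB.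
have /complex_realP[b bE] : `|B| \is Num.real by apply: normr_real.
have /complex_realP[d dE] := gtr0_real delta0.
have b0 : 0 <= b by rewrite -ler0c -bE.
have d0 : 0 < d by rewrite -ltcR -dE.
have db0 : 0 < d / (1 + b) by rewrite divr_gt0 // ltr_wpDr.
pose t := Num.min s (d / (1 + b)) / 2.
have m0 : 0 < Num.min s (d / (1 + b)) by rewrite lt_min s0.
have t0 : 0 < t by rewrite divr_gt0.
have : t < Num.min s (d / (1 + b)) by rewrite ltr_pdivrMr // ltr_pMr // ltr1n.
rewrite lt_min => /andP[ts td]; exists t; split => //.
  by apply: segment; rewrite t0.
apply: HP; rewrite mx_norm_ball /ball_ /= opprD addrA subrr sub0r normrN mx_normZ.
rewrite norm_real_complex gtr0_norm // bE dE -rmorphM ltcR.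
move: td; rewrite ltr_pdivlMr ?ltr_wpDr //; apply: le_lt_trans.
by rewrite mulrDr mulr1 lerDr ltW.
Qed.

(** Both expansions are compared at points [rho + t%:C *: A] of the manifold; dividing by [t] leaves
    [L A - L' A] smaller than any multiple of the norm of [A]. *)
Lemma is_differential_unique F rho L L' A : density rho -> tangent A ->
  is_differential F rho L -> is_differential F rho L' -> L A = L' A.
Proof.
move=> drho tA /is_differentialP[linL FL] /is_differentialP[linL' FL'].
have t0 : tangent (0 : 'M[R[i]]_n).
  by split; [apply/hermsymmxP; rewrite trmx0 map_mx0 | rewrite mxtrace0].
have homog (M : 'M[R[i]]_n -> 'M[R[i]]_n) (t : R) :
    (forall (a : R) A B, tangent A -> tangent B ->
     M (a%:C *: A + B) = a%:C *: M A + M B) -> M (t%:C *: A) = t%:C *: M A.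
  move=> linM; have M0 : M 0 = 0.
    have := congr1 (fun u => u - M 0) (linM 1 _ _ t0 t0).
    by rewrite scaler0 addr0 scale1r subrr addrK.
  by rewrite -[t%:C *: A]addr0 linM // M0 addr0.
apply/eqP; rewrite -subr_eq0 -normr_eq0; apply/negP => /negP D0.
have Dpos : 0 < `|L A - L' A| by rewrite lt0r D0 normr_ge0.
have A1 : 0 < `|A| + 1 by rewrite ltr_wpDl.
(* Chosen so that two remainders sum to the norm of [L A - L' A] times a ratio below 1. *)
pose e : R[i] := `|L A - L' A| / 2 / (`|A| + 1).
have e0 : 0 < e by rewrite !divr_gt0.
have [t [t_gt0 dt [/(_ dt) near_L /(_ dt) near_L']]] :=
  density_near drho tA (filterI (FL e e0) (FL' e e0)).
have shiftE : rho + t%:C *: A - rho = t%:C *: A by rewrite [rho + _]addrC addrK.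
move: near_L near_L'; rewrite shiftE (homog L) // (homog L') //.
move: (F _) => Fx near_L near_L'.
have diffE : (Fx - (F rho + t%:C *: L' A)) - (Fx - (F rho + t%:C *: L A)) =
    t%:C *: (L A - L' A).
  by rewrite opprB addrC addrA subrK opprD addrACA subrr add0r scalerBr.
have := ler_normB (Fx - (F rho + t%:C *: L' A)) (Fx - (F rho + t%:C *: L A)).
rewrite diffE mx_normZ.
have t0C : 0 < `|t%:C| by rewrite normr_gt0 gt_eqF // ltcR.
move=> le1; have := le_trans le1 (lerD near_L' near_L).
rewrite mx_normZ -mulrDl mulrCA ler_pM2l // /e -mulrDl -splitr.
rewrite mulrAC ler_pdivlMr // mulrDr mulr1 gerDl => Dle.
by have := lt_le_trans Dpos Dle; rewrite ltxx.
Qed.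

End DifferentialAmari.

(** * Equality case of Young's inequality *)

Section YoungEquality.
Local Open Scope sesquilinear_scope.
Local Open Scope complex_scope.
Context {R : realType}.
Implicit Types (a b s p : R).

Lemma powRVK s p : 0 <= s -> p != 0 -> (s `^ p^-1) `^ p = s.
Proof. by move=> s0 p0; rewrite -powRrM mulVf // powRr1. Qed.

(* Equality case: writing [a = m e^y] and [b = m e^z] with [m] the weighted
   geometric mean, so that [p y + p' z = 0], strict convexity is
   [1 + y < e^y] for [y != 0]. *)
Lemma weighted_amgm a b p (p' : R) : 0 < a -> 0 < b -> 0 < p -> 0 < p' -> p + p' = 1 ->
  a `^ p * b `^ p' <= p * a + p' * b /\
  (a `^ p * b `^ p' = p * a + p' * b -> a = b).
Proof.
move=> a0 b0 p0 p'0 pp'; set m := _ * _.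
have m0 : 0 < m by rewrite mulr_gt0 ?powR_gt0.
pose y := ln a - ln m; pose z := ln b - ln m.
have meanE (c : R) : 0 < c -> c = m * expR (ln c - ln m).
  by move=> c0; rewrite expRB !lnK ?posrE // mulrCA mulfV ?mulr1 ?gt_eqF.
have lnm : ln m = p * ln a + p' * ln b.
  by rewrite lnM ?posrE ?powR_gt0 // !ln_powR.
have yz : p * y + p' * z = 0.
  by rewrite /y /z !mulrBr addrACA -lnm -opprD -mulrDl pp' mul1r subrr.
have ey := expR_ge1Dx y; have ez := expR_ge1Dx z.
have gapE : p * a + p' * b - m =
    m * (p * (expR y - (1 + y)) + p' * (expR z - (1 + z))).
  rewrite {1}(meanE a a0) {1}(meanE b b0) -/y -/z.
  have -> : p * (expR y - (1 + y)) + p' * (expR z - (1 + z)) =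
    p * expR y + p' * expR z - (p + p') - (p * y + p' * z) by ring.
  by rewrite yz pp'; ring.
have py0 : 0 <= p * (expR y - (1 + y)) by rewrite mulr_ge0 ?subr_ge0 // ltW.
have pz0 : 0 <= p' * (expR z - (1 + z)) by rewrite mulr_ge0 ?subr_ge0 // ltW.
split=> [|mE]; first by rewrite -subr_ge0 gapE mulr_ge0 ?addr_ge0 // ltW.
have /eqP : m * (p * (expR y - (1 + y)) + p' * (expR z - (1 + z))) = 0.
  by rewrite -gapE -mE subrr.
rewrite mulf_eq0 (gt_eqF m0) paddr_eq0 //.
rewrite !mulf_eq0 (gt_eqF p0) (gt_eqF p'0) /= !subr_eq0.
move=> /andP[ey1 ez1].
have zero (x : R) : expR x == 1 + x -> x = 0.
  move=> ex; apply/eqP/negPn/negP => x0.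
  by have := expR_gt1Dx x0; rewrite (eqP ex) ltxx.
rewrite (meanE a a0) (meanE b b0) -/y -/z.
by rewrite (zero _ ey1) (zero _ ez1).
Qed.

Lemma young a s p (p' : R) : 0 < a -> 0 <= s -> 0 < p -> 0 < p' -> p + p' = 1 ->
  a `^ p * s <= p * a + p' * s `^ p'^-1 /\
  (a `^ p * s = p * a + p' * s `^ p'^-1 -> s = a `^ p').
Proof.
move=> a0; rewrite le_eqVlt => /predU1P[<-|s0] p0 p'0 pp'.
  rewrite powR0 ?invr_neq0 ?gt_eqF // !mulr0 addr0.
  by split=> [|/eqP]; rewrite ?mulr_ge0 ?ltW // lt_eqF // mulr_gt0.
have sE : s = (s `^ p'^-1) `^ p' by rewrite powRVK ?gt_eqF // ltW.
have [amgm amgm_eq] := weighted_amgm a0 (powR_gt0 p'^-1 s0) p0 p'0 pp'.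
by rewrite {1 3}sE; split=> // /amgm_eq->.
Qed.

End YoungEquality.

(** * The duality mapping on the Amari embedding *)

Section DualityMap.
Local Open Scope sesquilinear_scope.
Local Open Scope complex_scope.
Context {R : realType} {n : nat}.
Implicit Types (rho A V W T : 'M[R[i]]_n) (q : R).

Definition rudiag V (d : 'I_n -> R) : 'M[R[i]]_n := udiag V (fun i => (d i)%:C).

Lemma mxpow_rudiag V (d : 'I_n -> R) q : V \is unitarymx ->
  mxpow (rudiag V d) q = rudiag V (fun i => d i `^ q).
Proof. by move=> uV; apply: mxfun_udiag. Qed.

Lemma tr_rudiag V (d : 'I_n -> R) : V \is unitarymx ->
  \tr (rudiag V d) = (\sum_i d i)%:C.
Proof. by move=> uV; rewrite tr_udiag // rmorph_sum. Qed.

Lemma scale_rudiag V (d : 'I_n -> R) (c : R) :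
  c%:C *: rudiag V d = rudiag V (fun i => c * d i).
Proof.
rewrite /rudiag scale_udiag; congr udiag; apply/funext => i.
by rewrite rmorphM.
Qed.

Lemma mul_rudiag V (d e : 'I_n -> R) : V \is unitarymx ->
  rudiag V d *m rudiag V e = rudiag V (fun i => d i * e i).
Proof.
move=> uV; rewrite [LHS](mul_udiag _ _ uV); congr udiag; apply/funext => i.
by rewrite rmorphM.
Qed.

Lemma rudiag_adj V (d : 'I_n -> R) : (rudiag V d)^t* = rudiag V d.
Proof. by apply: udiag_adj => i; apply: real_complex_real. Qed.

Lemma rudiag_sqr V (d : 'I_n -> R) :
  udiag V (fun k => (d k)%:C ^+ 2) = rudiag V (fun k => d k ^+ 2).
Proof. by congr udiag; apply/funext => k; rewrite rmorphXn. Qed.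

(** The right half of a singular value decomposition. The eigenvalues of [W^t* *m W] are diagonal
    entries of a Gram matrix, hence nonnegative. *)
Lemma singular_values W : exists T, exists s : 'I_n -> R, [/\ T \is unitarymx,
  forall k, 0 <= s k, W^t* *m W = rudiag T (fun k => s k ^+ 2) &
  mxabs W = rudiag T s].
Proof.
have hWW : W^t* *m W \is hermsymmx.
  by apply/hermsymmxP; rewrite trmx_mul map_mxM trmxCK.
pose T := spectralmx (W^t* *m W).
have uT : T \is unitarymx by apply: spectral_unitarymx.
have sigma0 k : 0 <= eigval (W^t* *m W) k.
  rewrite -ler0c.
  have -> : (eigval (W^t* *m W) k)%:C = (T *m (W^t* *m W) *m T^t*) k k.
    rewrite {2}(hermitian_eigval hWW) mulmx_udiagl // -mulmxA unitary_mulV //.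
    by rewrite mulmx1 !mxE eqxx mulr1n.
  have -> : T *m (W^t* *m W) *m T^t* = (W *m T^t*)^t* *m (W *m T^t*).
    by rewrite trmx_mul map_mxM trmxCK !mulmxA.
  by rewrite gram_diagE sumr_ge0 // => j _; rewrite exprn_ge0.
exists T, (fun k => Num.sqrt (eigval (W^t* *m W) k)); split=> //.
- rewrite {1}(hermitian_eigval hWW); congr udiag; apply/funext => k.
  by rewrite sqr_sqrtr.
- by rewrite /mxabs mxfunE.
Qed.

Lemma mxabs_rudiag V (d : 'I_n -> R) : V \is unitarymx -> (forall i, 0 <= d i) ->
  mxabs (rudiag V d) = rudiag V d.
Proof.
move=> uV d0; rewrite /mxabs rudiag_adj.
rewrite (mul_rudiag _ _ uV).
rewrite (mxfun_udiag _ _ uV).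
congr udiag; apply/funext => i.
by rewrite -expr2 sqrtr_sqr ger0_norm.
Qed.

Lemma normNE q T (s : 'I_n -> R) W : T \is unitarymx -> mxabs W = rudiag T s ->
  normN q W = q^-1 * (\sum_k s k `^ q) `^ q^-1.
Proof. by move=> uT WE; rewrite /normN WE mxpow_rudiag // tr_rudiag. Qed.

Lemma density_spectral rho : density rho ->
  rho = rudiag (spectralmx rho) (eigval rho).
Proof. by move=> [[hrho _] _]; apply: hermitian_eigval. Qed.

Lemma sum_eigval rho : density rho -> \sum_i eigval rho i = 1.
Proof.
move=> drho; have [_ trrho] := drho; apply: (@complexI R).
by rewrite -(tr_rudiag _ (spectral_unitarymx rho)) -density_spectral // trrho.
Qed.

Lemma amariE q rho :
  amari q rho = rudiag (spectralmx rho) (fun i => q * eigval rho i `^ q^-1).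
Proof. by rewrite /amari /mxpow mxfunE scale_rudiag. Qed.

Lemma normN_amari q rho : 0 < q -> density rho -> normN q (amari q rho) = 1.
Proof.
move=> q0 drho; have uS := spectral_unitarymx rho.
have l0 i : 0 < eigval rho i by apply: eigval_gt0 drho.1.
rewrite (@normNE _ (spectralmx rho) (fun i => q * eigval rho i `^ q^-1)) //; last first.
  by rewrite amariE mxabs_rudiag // => i; rewrite mulr_ge0 ?powR_ge0 // ltW.
have -> : \sum_k (q * eigval rho k `^ q^-1) `^ q = q `^ q.
  rewrite -[RHS]mulr1 -(sum_eigval drho) mulr_sumr; apply: eq_bigr => k _.
  by rewrite powRM ?powR_ge0 ?(ltW q0) // powRVK ?gt_eqF // ltW.
by rewrite -powRrM mulfV ?gt_eqF // powRr1 ?(ltW q0) // mulVf ?gt_eqF.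
Qed.

(** The candidate qualifies because the powers of [rho] with exponents [q^-1] and [qt^-1] multiply
    to [rho], of trace 1. Any competitor, divided by [qt], attains equality in the trace Hölder
    inequality and so is determined. *)
Lemma duality_map_amari q (qt : R) rho : 0 < q -> 0 < qt -> q^-1 + qt^-1 = 1 ->
  density rho -> duality_map q qt (amari q rho) = amari qt rho.
Proof.
move=> q0 qt0 qqt drho; have uS := spectral_unitarymx rho.
have l0 i : 0 < eigval rho i by apply: eigval_gt0 drho.1.
have scaledE (r : R) : 0 < r -> (r^-1)%:C *: amari r rho =
    rudiag (spectralmx rho) (fun i => eigval rho i `^ r^-1).
  move=> r0; rewrite amariE scale_rudiag; congr rudiag; apply/funext => i.
  by rewrite mulrA mulVf ?mul1r // gt_eqF.
rewrite /duality_map normN_amari //; apply: xget_unique.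
  rewrite /= normN_amari //; split=> //.
  rewrite /pairing !scaledE // mul_rudiag // tr_rudiag // expr1n.
  congr (_%:C); rewrite -(sum_eigval drho); apply: eq_bigr => i _.
  by rewrite -powRD ?(gt_eqF (l0 i)) ?implybT // qqt powRr1 // ltW.
move=> W [pairW normW]; have [T [s [uT s0 WW absW]]] := singular_values W.
(* The singular values of [W] divided by [qt]; the norm condition becomes that their powers [qt] sum
   to 1. *)
pose s1 k := qt^-1 * s k.
have s1_ge0 k : 0 <= s1 k by rewrite mulr_ge0 // invr_ge0 ltW.
have sum_s1 : \sum_k s1 k `^ qt = 1.
  have normW1 : normN qt W = 1.
    apply/eqP; rewrite -(@eqrXn2 _ 2) // -?normW ?expr1n //.
    by rewrite mulr_ge0 ?powR_ge0 // invr_ge0 ltW.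
  move: normW1; rewrite (normNE _ uT absW) => normW1.
  have sum0 : 0 <= \sum_k s k `^ qt by apply: sumr_ge0 => k _; apply: powR_ge0.
  have -> : \sum_k s1 k `^ qt = (qt^-1) `^ qt * \sum_k s k `^ qt.
    rewrite mulr_sumr; apply: eq_bigr => k _.
    by rewrite powRM // invr_ge0 ltW.
  rewrite -[X in _ * X](powRVK sum0 (lt0r_neq0 qt0)) -powRM ?powR_ge0 //.
    by rewrite normW1 powR1.
  by rewrite invr_ge0 ltW.
have W1E : (qt^-1)%:C *: W = rudiag (spectralmx rho) (fun i => eigval rho i `^ qt^-1).
  have := @trace_holder_eq _ _ (spectralmx rho) T ((qt^-1)%:C *: W)
    (fun i => (eigval rho i `^ q^-1)%:C) (fun i => (eigval rho i `^ qt^-1)%:C)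
    (fun i => (eigval rho i)%:C) (fun k => (s1 k)%:C)
    (fun k => (s1 k `^ qt)%:C) (q^-1)%:C (qt^-1)%:C uS uT.
  apply.
  - by move=> i; rewrite ltcR powR_gt0.
  - by move=> i; rewrite ltcR powR_gt0.
  - by move=> k; rewrite ler0c.
  - by move=> i; rewrite ler0c ltW.
  - by move=> k; rewrite ler0c powR_ge0.
  - by rewrite ler0c invr_ge0 ltW.
  - by rewrite ler0c invr_ge0 ltW.
  - by rewrite -rmorphD /= qqt.
  - rewrite (adjmxZ _ (real_complex_real _)).
    rewrite -scalemxAl -scalemxAr WW scalerA -rmorphM /= scale_rudiag.
    rewrite rudiag_sqr; congr udiag; apply/funext => k.
    by rewrite /s1 exprMn expr2.
  - by rewrite -rmorph_sum /= sum_eigval.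
  - by rewrite -rmorph_sum /= sum_s1.
  - move=> i k; rewrite -!rmorphM -rmorphD /= lecR.
    have := (young (l0 i) (s1_ge0 k) _ _ qqt).1; rewrite invrK.
    by apply; rewrite invr_gt0.
  - move=> i k; rewrite -!rmorphM -rmorphD /= => /complexI tight; congr (_%:C).
    have := (young (l0 i) (s1_ge0 k) _ _ qqt).2; rewrite invrK.
    by apply=> //; rewrite invr_gt0.
  - by move: pairW; rewrite /pairing scaledE // expr1n.
have -> : W = qt%:C *: ((qt^-1)%:C *: W).
  by rewrite scalerA -rmorphM /= mulfV ?scale1r // gt_eqF.
by rewrite W1E amariE scale_rudiag.
Qed.

End DualityMap.

(** * Differential of the Amari embedding *)

Section AmariDifferential.
Local Open Scope sesquilinear_scope.
Local Open Scope complex_scope.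
Context {R : realType} {n : nat}.
Implicit Types (rho A B U : 'M[R[i]]_n) (p q r x y : R).
Implicit Types (F L : 'M[R[i]]_n -> 'M[R[i]]_n).

Definition powdiff r : R -> R -> R :=
  divdiff (@powR R ^~ r) (fun z => r * z `^ (r - 1)).

Definition amari_diff q rho A : 'M[R[i]]_n :=
  q%:C *: mxfunLR (powdiff q^-1) rho A.

Lemma is_differential_amari q rho : 1 <= q -> density rho ->
  is_differential (amari q) rho (amari_diff q rho).
Proof.
move=> q1 drho; apply: is_differentialZ; apply: is_differential_mxfun => //.
move=> y z y0 z0; apply: divdiff_powR_tame => //.
by rewrite invr_gt0 (lt_le_trans ltr01 q1) invf_le1 // (lt_le_trans ltr01 q1).
Qed.

Lemma differentialE F rho L A : density rho -> tangent A ->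
  is_differential F rho L -> differential F rho A = L A.
Proof.
move=> drho tA FL; rewrite /differential.
have := @xgetI _ (fun=> 0) [set L | is_differential F rho L] L FL.
by move=> /(is_differential_unique drho tA); apply.
Qed.

(** By homogeneity everything is expressed through [u = y / x] and the powers of [x], leaving a
    rational identity. On the diagonal the product of the two derivatives is [p * (1 - p)] over
    [x]. *)
Lemma powdiff_mul_chentsov p x y : 0 < p < 1 -> 0 < x -> 0 < y ->
  powdiff p x y * powdiff (1 - p) y x =
  p * (1 - p) * chentsov_fun (WYD_fun p) y x.
Proof.
move=> /andP[p0 p1] x0 y0; rewrite /powdiff /divdiff /chentsov_fun /WYD_fun.
rewrite (eq_sym y); have [<-|xy] := eqVneq x y.
  rewrite (divff (lt0r_neq0 x0)) eqxx mulr1 mulrACA -powRD ?lt0r_neq0 ?implybT //.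
  by rewrite (_ : p - 1 + (1 - p - 1) = -1) ?powR_inv1 ?ltW //; ring.
have u0 : 0 < y / x by rewrite divr_gt0.
have yE : y = y / x * x by rewrite mulfVK ?gt_eqF.
have u1 : y / x != 1.
  by apply: contra_neq xy => u1; rewrite yE u1 mul1r.
have powu_neq1 r : r != 0 -> (y / x) `^ r - 1 != 0.
  by move=> r0; rewrite subr_eq0 powR_eq1 (negPf u1) (negPf r0) ltNge ltW.
have a1 := powu_neq1 _ (lt0r_neq0 p0).
have q0 : 1 - p != 0 by rewrite subr_eq0 gt_eqF.
have b1 := powu_neq1 _ q0.
have xE : x = x `^ p * x `^ (1 - p).
  by rewrite -powRD ?lt0r_neq0 ?implybT // (_ : p + (1 - p) = 1) ?powRr1 ?ltW //; ring.
have yrE r : y `^ r = (y / x) `^ r * x `^ r by rewrite -powRM ?ltW // -yE.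
rewrite (negPf u1) (yrE p) (yrE (1 - p)).
have -> : x - y = (1 - y / x) * x by rewrite mulrBl mul1r -yE.
have -> : y - x = (y / x - 1) * x by rewrite mulrBl mul1r -yE.
have P0 : x `^ p != 0 by rewrite lt0r_neq0 ?powR_gt0.
have Q0 : x `^ (1 - p) != 0 by rewrite lt0r_neq0 ?powR_gt0.
rewrite -subr_eq0 in u1.
have {}p0 := lt0r_neq0 p0.
move: (y / x) (x `^ p) (x `^ (1 - p)) a1 b1 u1 xE P0 Q0.
move=> u P Q a1 b1 u1 -> P0 Q0; field; rewrite p0 q0 a1 b1 u1 P0 Q0 /=.
by rewrite -oppr_eq0 opprB.
Qed.

Lemma commutator_tangent rho U : density rho -> U \is hermsymmx ->
  tangent ('i *: commutator rho U).
Proof.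
move=> [[hrho _] _] hU; split.
  exact: (commutator_herm hrho hU).
by rewrite mxtraceZ linearB /= mxtrace_mulC subrr mulr0.
Qed.

Lemma amari_diff_commutator q rho U : density rho ->
  amari_diff q rho ('i *: commutator rho U) =
  q%:C *: ('i *: commutator (mxpow rho q^-1) U).
Proof.
move=> drho; congr (_ *: _); have [[hrho _] _] := drho.
have cE (i j : 'I_n) : (powdiff q^-1 (eigval rho i) (eigval rho j))%:C *
    ((eigval rho i)%:C - (eigval rho j)%:C) =
    (eigval rho i `^ q^-1)%:C - (eigval rho j `^ q^-1)%:C.
  by rewrite -!rmorphB -rmorphM /= -(opprB (eigval rho j)) mulrN divdiff_mul opprB.
have := sandwich_commutator (Complex 0 1) U (spectral_unitarymx rho) cE.
rewrite -hermitian_eigval // -mxfunLRE -(mxfunE (@powR R ^~ q^-1)).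
exact.
Qed.

End AmariDifferential.

(** * The dualised pull-back *)

Section DualPullback.
Local Open Scope sesquilinear_scope.
Local Open Scope complex_scope.
Context {R : realType} {n : nat}.
Implicit Types (rho A B U : 'M[R[i]]_n) (p q qt : R).

(** On density matrices the composite is the Amari embedding of parameter [qt], and a differential
    depends only on values there. *)
Lemma is_differential_dual_amari q qt rho : 1 < q -> 1 < qt -> q^-1 + qt^-1 = 1 ->
  density rho ->
  is_differential (duality_map q qt \o amari q) rho (amari_diff qt rho).
Proof.
move=> q1 qt1 qqt drho.
apply: (@eq_is_differential _ _ (amari qt)) => // [x dx|].
  by rewrite /= duality_map_amari // (lt_trans ltr01).
exact: is_differential_amari (ltW qt1) drho.
Qed.

Lemma pairingZ q qt A B : q != 0 -> qt != 0 ->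
  pairing q qt (q%:C *: A) (qt%:C *: B) = \tr (A *m B).
Proof.
move=> q0 qt0; rewrite /pairing !scalerA -!rmorphM /=.
by rewrite mulVf // mulVf // !scale1r.
Qed.

Lemma dual_pullback_amari q qt rho A B : 1 < q -> 1 < qt -> q^-1 + qt^-1 = 1 ->
  density rho -> tangent A -> tangent B ->
  dual_pullback q qt (amari q) rho A B =
  pairing q qt (amari_diff q rho A) (amari_diff qt rho B).
Proof.
move=> q1 qt1 qqt drho tA tB; rewrite /dual_pullback.
rewrite (differentialE drho tA (is_differential_amari (ltW q1) drho)).
by rewrite (differentialE drho tB (is_differential_dual_amari q1 qt1 qqt drho)).
Qed.

Lemma tr_mxfunLR_monotone_metric p rho A B : 0 < p < 1 -> density rho ->
  \tr (mxfunLR (powdiff p) rho A *m mxfunLR (powdiff (1 - p)) rho B) =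
  (p * (1 - p))%:C * monotone_metric (WYD_fun p) rho A B.
Proof.
move=> p01 drho; rewrite /monotone_metric !mxfunLRE.
have l0 i : 0 < eigval rho i by apply: eigval_gt0 drho.1.
apply: (tr_sandwich_mul A B (spectral_unitarymx rho)) => i j.
rewrite -[LHS]rmorphM -[RHS]rmorphM.
by rewrite powdiff_mul_chentsov.
Qed.

Lemma tr_commutator_i A B :
  \tr (('i *: A) *m ('i *: B)) = - \tr (A *m B).
Proof.
by rewrite -scalemxAl -scalemxAr scalerA mxtraceZ -expr2 sqr_i mulN1r.
Qed.

End DualPullback.

Theorem proposition3p4 (R : realType) (n : nat) (p q qt : R)
    (hp : 0 < p < 1) (hq : q = 1 / p) (hqt : 1 / q + 1 / qt = 1) :
  (forall rho : 'M[R[i]]_n, density rho ->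
     differentiable_density (amari q) rho /\
     differentiable_density (duality_map q qt \o amari q) rho) /\
  is_WYD_metric p (dual_pullback q qt (@amari R n q)).
Proof.
have /andP[p0 p1] := hp.
have qV : q^-1 = p by rewrite hq mul1r invrK.
have qtV : qt^-1 = 1 - p.
  by move: hqt; rewrite !mul1r qV => <-; rewrite [p + _]addrC addrK.
have qqt : q^-1 + qt^-1 = 1 by rewrite qV qtV addrC subrK.
have q1 : 1 < q by rewrite -[q]invrK qV invf_gt1.
have qt1 : 1 < qt.
  by rewrite -[qt]invrK qtV invf_gt1 ?subr_gt0 // gtrBl.
have q0 : q != 0 by rewrite gt_eqF // (lt_trans ltr01).
have qt0 : qt != 0 by rewrite gt_eqF // (lt_trans ltr01).
split=> [rho drho|].
  split; first by exists (amari_diff q rho); apply: is_differential_amari (ltW q1) drho.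
  by exists (amari_diff qt rho); apply: is_differential_dual_amari.
(* This scalar cancels the normalizing factor of [WYD_fun p], which stands in the denominator of the
   Chentsov function. *)
exists (p * (1 - p)); split=> [rho A B drho tA tB|rho U drho hU].
  rewrite dual_pullback_amari // /amari_diff pairingZ // qV qtV.
  exact: tr_mxfunLR_monotone_metric.
have tU := commutator_tangent drho hU.
rewrite dual_pullback_amari // !amari_diff_commutator // pairingZ //.
by rewrite tr_commutator_i qV qtV.
Qed.
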